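(* Let $n\ge 2$ be an integer and $p \in \{0,\dots,n\}$. The Ricci curvature of $(GLSym_n(p), g)$ is $$Ric_Q(X,Z) = \frac{1}{4}\,\mathrm{tr}(Q^{-1}X)\,\mathrm{tr}(Q^{-1}Z) - \frac{n}{4}\, g_Q(X,Z)$$ for every $Q \in GLSym_n(p)$ and all $X, Z \in T_Q(GLSym_n(p)) = Sym_n$, and the scalar curvature of $(GLSym_n(p), g)$ is $$S = -\frac{(n-1)\,n\,(n+2)}{8}.$$
   Context: $Sym_n$ is the vector space of real symmetric $n\times n$ matrices. $GLSym_n(p)$ ($0\le p\le n$) is the set of non-singular matrices in $Sym_n$ with signature $(p,n-p)$ ($p$ positive and $n-p$ negative eigenvalues); it is open in $Sym_n$. The trace metric $g$ is the semi-Riemannian metric on $GLSym_n(p)$ given by $g_A(V,W)=\mathrm{tr}(A^{-1}VA^{-1}W)$ for $A\in GLSym_n(p)$, $V,W\in Sym_n$. The usual sign convention for Ricci curvature is used (positive on round spheres). *)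

(* Defs.v *)
From HB Require Import structures.
From mathcomp Require Import all_boot all_order all_algebra.
From mathcomp Require Import all_classical all_reals all_analysis.
Import Order.TTheory GRing.Theory Num.Theory.
Import numFieldNormedType.Exports.

Set Implicit Arguments.
Unset Strict Implicit.
Unset Printing Implicit Defensive.

Local Open Scope classical_set_scope.
Local Open Scope ring_scope.

(* Semi-Riemannian geometry of an open subset [U] of a linear subspace [E] of
   the space of [n x n] matrices, seen in its global chart: each tangent space of
   [U] is [E], and [g Q x y] is the metric at [Q].  Derivatives are only taken at
   points of [E] in directions of [E], so that what follows depends, at a point
   [Q] of [U], only on the values of [g] at the points of [E] near [Q]; these
   lie in [U] as [U] is open in [E].  Hence [U] is not a parameter, and the values
   of [g] outside [U] do not matter. *)
Section Semi_Riemannian.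
Context {R : realType} {n : nat}.
Local Notation V := 'M[R]_n.
Implicit Types (E : {vspace V}) (g B : V -> V -> V -> R).

(* [G] is the difference, at one point, between a connection and the flat
   connection of [E]. *)
Definition connection_form E (G : V -> V -> V) : Prop :=
  [/\ {in E &, forall x y, G x y \in E},
      forall a, {in E & &, forall x x' y,
        G (a *: x + x') y = a *: G x y + G x' y} &
      forall a, {in E & &, forall x y y',
        G x (a *: y + y') = a *: G x y + G x y'}].

(* Vanishing of the torsion, tested on constant vector fields (whose Lie
   brackets are zero). *)
Definition torsion_free E (G : V -> V -> V) : Prop :=
  {in E &, forall x y, G x y = G y x}.

(* [nabla g = 0] at the point [Q], tested on constant vector fields. *)
Definition metric_compatible E g (Q : V) (G : V -> V -> V) : Prop :=
  {in E & &, forall x y z,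
    'D_x (fun P => g P y z) Q = g Q (G x y) z + g Q y (G x z)}.

(* At a point where the metric is differentiable and non-degenerate on [E] the
   three conditions determine [G] uniquely on [E]. *)
Definition levi_civita E g (Q : V) : V -> V -> V :=
  xget (fun _ _ => 0)
    [set G | [/\ connection_form E G, torsion_free E G
               & metric_compatible E g Q G]].

(* Covariant derivative of the vector field [Y] along [X]. *)
Definition nabla E g (X Y : V -> V) : V -> V :=
  fun Q => 'D_(X Q) Y Q + levi_civita E g Q (X Q) (Y Q).

Definition lie_bracket (X Y : V -> V) : V -> V :=
  fun Q => 'D_(X Q) Y Q - 'D_(Y Q) X Q.

Definition curvature E g (X Y Z : V -> V) : V -> V :=
  fun Q => nabla E g X (nabla E g Y Z) Q - nabla E g Y (nabla E g X Z) Q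
           - nabla E g (lie_bracket X Y) Z Q.

Definition trace_on E (F : V -> V) : R :=
  \sum_(i < \dim E) coord (vbasis E) i (F (vbasis E)`_i).

(* The trace of [y |-> R(y, x) z].  Curvature is a tensor, so tangent vectors may
   be extended to constant vector fields. *)
Definition ricci E g (Q x z : V) : R :=
  trace_on E (fun y => curvature E g (cst y) (cst x) (cst z) Q).

Definition gram E B (Q : V) : 'M[R]_(\dim E) :=
  \matrix_(i, j) B Q (vbasis E)`_i (vbasis E)`_j.

(* The trace of [ricci] with respect to [g], that is [g^{ij} Ric_{ij}]. *)
Definition scalar_curvature E g (Q : V) : R :=
  \tr (invmx (gram E g Q) *m gram E (ricci E g) Q).

End Semi_Riemannian.

Section Symmetric_matrices.
Context {R : realType}.
Implicit Types n p : nat.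

Definition Sym n : {vspace 'M[R]_n} := fixedSpace (linfun (@trmx R n n)).

Lemma in_Sym n (A : 'M[R]_n) : (A \in Sym n) = (A^T == A).
Proof. by apply/fixedSpaceP/eqP; rewrite lfunE. Qed.

(* [s] lists the eigenvalues of [A], with multiplicity. *)
Definition has_signature n (A : 'M[R]_n) (p q : nat) : Prop :=
  exists s : seq R, [/\ char_poly A = \prod_(a <- s) ('X - a%:P),
    count (fun a => 0 < a) s = p & count (fun a => a < 0) s = q].

Definition GLSym n p : set 'M[R]_n :=
  [set A | [/\ A \in Sym n, A \in unitmx & has_signature A p (n - p)]].

Definition trace_metric n (A X Y : 'M[R]_n) : R :=
  \tr (invmx A *m X *m invmx A *m Y).

End Symmetric_matrices.

Arguments Sym {R} n.
Arguments GLSym {R} n p.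
Arguments trace_metric {R n} A X Y.

(* Main.v *)
From mathcomp Require Import perm.
Require Import Defs.
From HB Require Import structures.
From mathcomp Require Import all_boot all_order all_algebra.
From mathcomp Require Import all_classical all_reals all_analysis.
From mathcomp Require Import ring lra.
Import Order.TTheory GRing.Theory Num.Theory.
Import numFieldNormedType.Exports.

Set Implicit Arguments.
Unset Strict Implicit.
Unset Printing Implicit Defensive.

Local Open Scope classical_set_scope.
Local Open Scope ring_scope.

(** Write q for the inverse of Q.  Everything rests on the derivative of the
    inverse, -q x q in the direction x.

    - Differentiating tr(q y q z) gives -tr(q x q y q z) - tr(q y q x q z), and
      cyclicity of the trace splits this as g(G(x,y),z) + g(y,G(x,z)) with
      G(x,y) = -(x q y + y q x)/2.  This G is symmetric in x and y and preserves
      symmetric matrices, so by the uniqueness argument of Koszul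
      ([levi_civitaE], [levi_civita_trace_metric]) it is the Levi-Civita
      connection in the global chart.
    - Differentiating G once more along the line through Q and composing G with
      itself, the terms in which z stands between x and y cancel in the
      curvature, which leaves ([curvature_trace_metric])
      R(y,x)z = (x q y q z + z q y q x - y q x q z - z q x q y) / 4.
    - As a function of y this is a combination of two maps of the form
      y |-> a y b + b^T y a^T, whose trace on the symmetric matrices is
      tr a tr b + tr(a^T b) ([trace_on_Sym]).  With a = x q, b = q z, and then
      a = 1, b = q x q z, the two copies of tr(q x q z) cancel and the Ricci
      curvature is (tr(q x) tr(q z) - n g(x,z)) / 4.
    - The linear form tr(q x) is g(Q,x), of squared length g(Q,Q) = n.
      Contracting with g thus gives (n - n dim Sym_n) / 4, where the dimension
      n(n+1)/2 is itself half the trace formula at a = b = 1 ([dim_Sym]).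

    All derivatives are taken along the lines h |-> h x + Q: they stay in the
    symmetric matrices, where the Levi-Civita connection is determined, and they
    stay invertible for small h. *)

(** * Derivatives of matrix-valued functions *)

Lemma is_derive_mxP (R : realFieldType) (V : normedModType R) (m n : nat)
    (M : V -> 'M[R]_(m, n)) t v (D : 'M[R]_(m, n)) :
  is_derive t v M D <->
  forall i j, is_derive t v (fun x => M x i j) (D i j).
Proof.
split=> [[/[dup] dM /derivable_mxP dMij <-] i j | dM].
  by apply: DeriveDef => //; rewrite derive_mx// mxE.
have dMt : derivable M t v by apply/derivable_mxP => i j; exact: ex_derive.
apply: DeriveDef => //; rewrite derive_mx//.
by apply/matrixP => i j; rewrite mxE derive_val.
Qed.

Lemma is_derive_mulmx (R : realFieldType) (V : normedModType R) (m n p : nat)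
    (M : V -> 'M[R]_(m, n)) (N : V -> 'M[R]_(n, p)) t v dM dN :
  is_derive t v M dM -> is_derive t v N dN ->
  is_derive t v (fun x => M x *m N x) (dM *m N t + M t *m dN).
Proof.
move=> /is_derive_mxP dMt /is_derive_mxP dNt; apply/is_derive_mxP => i j.
rewrite (_ : (fun x => _) =
    \sum_k ((fun x => M x i k) * (fun x => N x k j))); last first.
  by apply/funext => x; rewrite fct_sumE mxE.
apply: is_derive_eq; rewrite !mxE -big_split; apply: eq_bigr => k _ /=.
by rewrite addrC /GRing.scale /=; congr (_ + _); rewrite mulrC.
Qed.

Lemma is_derive_mxtrace (R : realFieldType) (V : normedModType R) (n : nat)
    (M : V -> 'M[R]_n) t v dM :
  is_derive t v M dM -> is_derive t v (fun x => \tr (M x)) (\tr dM).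
Proof.
move=> /is_derive_mxP dMt.
rewrite (_ : (fun x => _) = \sum_k (fun x => M x k k)); last first.
  by apply/funext => x; rewrite fct_sumE.
exact: is_derive_sum.
Qed.

(** By the Leibniz formula the determinant is a polynomial in the entries. *)
Lemma derivable_det (R : realFieldType) (V : normedModType R) (n : nat)
    (M : V -> 'M[R]_n) t v :
  derivable M t v -> derivable (fun x => \det (M x)) t v.
Proof.
move=> /derivable_mxP dM.
rewrite (_ : (fun x => _) = \sum_(s : 'S_n)
    (cst ((-1) ^+ s) * \prod_i (fun x => M x i (s i)))); last first.
  apply/funext => x; rewrite fct_sumE; apply: eq_bigr => s _ /=.
  rewrite [RHS]/GRing.mul/=; congr (_ * _).
  by elim/big_rec2 : _ => // i f g _ ->.
elim/big_ind : _ => [|f g|s _]; [exact: derivable_cst|exact: derivableD|].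
apply: derivableM; first exact: derivable_cst.
by elim/big_ind : _ => [|f g|i _]; [exact: derivable_cst|exact: derivableM|].
Qed.

Section curves.
Context {R : realType} {n : nat}.
Implicit Types (M : R -> 'M[R]_n) (t : R).

Lemma near_unitmx M t : derivable M t 1 -> M t \in unitmx ->
  \forall s \near t, M s \in unitmx.
Proof.
move=> dM; rewrite unitmxE unitfE => Mt0.
have /derivable1_diffP/differentiable_continuous dc := derivable_det dM.
near=> s; rewrite unitmxE unitfE; near: s.
suff /dc : nbhs (\det (M t)) [set y | y != 0] by [].
by apply: open_nbhs_nbhs; split => //; exact: open_neq.
Unshelve. all: by end_near. Qed.

(** Near [t] the inverse is the adjugate divided by the determinant, and the
    cofactors are determinants again. *)
Lemma derivable_invmx M t : derivable M t 1 -> M t \in unitmx ->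
  derivable (fun s => invmx (M s)) t 1.
Proof.
move=> dM Mt; apply: (@near_eq_derivable _ _ _
  (fun s => (\det (M s))^-1 *: \adj (M s))).
  near=> s; rewrite /invmx ifT//; near: s; exact: near_unitmx.
apply/derivable_mxP => i j.
rewrite (_ : (fun s => _) =
  (fun s => (\det (M s))^-1) * (fun s => \adj (M s) i j)); last first.
  by apply/funext => s; rewrite mxE.
apply: derivableM.
  by apply: derivableV; [rewrite -unitfE -unitmxE|exact: derivable_det].
rewrite (_ : (fun s => _) =
  cst ((-1) ^+ (j + i)) * (fun s => \det (row' j (col' i (M s))))); last first.
  by apply/funext => s; rewrite mxE.
apply: derivableM; first exact: derivable_cst.
apply: derivable_det; apply/derivable_mxP => k l.
move/derivable_mxP: dM => /(_ (lift j k) (lift i l)).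
suff -> : (fun s => row' j (col' i (M s)) k l) =
  (fun s => M s (lift j k) (lift i l)) by [].
by apply/funext => s; rewrite !mxE.
Unshelve. all: by end_near. Qed.

(** The product of [M] and its inverse is constant near [t]; the Leibniz rule
    then gives the derivative of the second factor. *)
Lemma is_derive_invmx M t dM : is_derive t 1 M dM -> M t \in unitmx ->
  is_derive t 1 (fun s => invmx (M s)) (- (invmx (M t) *m dM *m invmx (M t))).
Proof.
move=> dMt Mt.
have /derivableP dI : derivable (fun s => invmx (M s)) t 1.
  by apply: derivable_invmx.
apply: (is_derive_eq dI).
have [_ dMI] := is_derive_mulmx dMt dI.
have : 'D_1 (fun s => M s *m invmx (M s)) t = 'D_1 (cst 1%:M) t.
  apply: near_eq_derive; near=> s; rewrite mulmxV//; near: s.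
  exact: near_unitmx.
rewrite dMI derive_cst => /(congr1 (mulmx (invmx (M t)))).
by rewrite mulmxDr mulKmx// mulmx0 mulmxA addrC => /eqP; rewrite addr_eq0 => /eqP.
Unshelve. all: by end_near. Qed.

End curves.

(** A directional derivative only sees one line.  This reduces the calculus to
    curves, and allows a function to be replaced by another that agrees with it on
    that line only. *)
Lemma is_derive_line (R : realType) (V W : normedModType R) (f : V -> W)
    (x v : V) (df : W) :
  is_derive x v f df <->
  is_derive (0 : R) (1 : R) (fun h : R => f (h *: v + x)) df.
Proof.
suff eq_growth : (fun h : R => h^-1 *:
    (((fun h : R => f (h *: v + x)) \o shift 0) (h *: 1) -
     f (0 *: v + x))) =
  (fun h => h^-1 *: ((f \o shift x) (h *: v) - f x)).
  by split=> -[d e]; split; move: d e; rewrite /derivable /derive eq_growth.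
by apply/funext => h /=; rewrite addr0 scale0r add0r [_%:A]mulr1.
Qed.

Lemma is_derive_affine (R : realType) (V : normedModType R) (x v : V) :
  is_derive (0 : R) (1 : R) (fun h : R => h *: v + x) v.
Proof. exact: (is_derive_line id x v v).1 (is_derive_id x v). Qed.

(** * The Levi-Civita connection *)

(** Koszul's argument.  The difference of two such connections, lowered with the
    metric, is a trilinear form that is symmetric in its first two arguments and
    antisymmetric in the last two, hence zero. *)
Lemma levi_civitaE (R : realType) (n : nat) (E : {vspace 'M[R]_n})
    (g : 'M[R]_n -> 'M[R]_n -> 'M[R]_n -> R) (Q : 'M[R]_n)
    (G : 'M[R]_n -> 'M[R]_n -> 'M[R]_n) :
  {in E &, forall x y, g Q x y = g Q y x} ->
  {in E & &, forall x x' y, g Q (x - x') y = g Q x y - g Q x' y} ->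
  {in E, forall x, {in E, forall y, g Q x y = 0} -> x = 0} ->
  connection_form E G -> torsion_free E G -> metric_compatible E g Q G ->
  {in E &, levi_civita E g Q =2 G}.
Proof.
move=> gC gB g_nondeg cG tG mG x y xE yE; rewrite /levi_civita.
set P := (X in xget _ X).
have [[L_E _ _] tL mL] : P (xget (fun _ _ => 0) P).
  by apply: (@xgetI _ _ P G); split.
move: (xget _ P) L_E tL mL => L LE tL mL.
have [GE _ _] := cG; apply/eqP; rewrite -subr_eq0; apply/eqP.
apply: g_nondeg => [|z zE]; first by rewrite rpredB ?LE ?GE.
pose T a b c := g Q (L a b - G a b) c.
have TC a b c : a \in E -> b \in E -> T a b c = T b a c.
  by move=> aE bE; rewrite /T tL// tG.
have TN a b c : a \in E -> b \in E -> c \in E -> T a b c = - T a c b.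
  move=> aE bE cE; rewrite /T !gB ?LE ?GE//.
  have := mL a b c aE bE cE; rewrite mG//.
  by rewrite [g Q b (G a c)]gC ?GE// [g Q b (L a c)]gC ?LE//; lra.
have : T x y z = - T x y z.
  (* Six swaps, alternately of the first two and of the last two arguments,
     return to [x, y, z] with an odd number of sign changes. *)
  by rewrite {1}TN// TC// TN// opprK TC// TN// TC.
by rewrite -/(T x y z); lra.
Qed.

Section Symmetric.
Context {R : realType} {n : nat}.
Local Notation V := 'M[R]_n.
Implicit Types Q x y z : V.

Lemma SymP x : reflect (x^T = x) (x \in Sym n).
Proof. by rewrite in_Sym; exact: eqP. Qed.

Lemma trmx_invSym Q : Q \in Sym n -> (invmx Q)^T = invmx Q.
Proof. by move=> /SymP QE; rewrite trmx_inv QE. Qed.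

Lemma trace_metricC Q x y : trace_metric Q x y = trace_metric Q y x.
Proof. by rewrite /trace_metric -mulmxA mxtrace_mulC !mulmxA. Qed.

Lemma trace_metricD Q (c : R) x x' y :
  trace_metric Q (c *: x + x') y = c * trace_metric Q x y + trace_metric Q x' y.
Proof.
by rewrite /trace_metric mulmxDr !mulmxDl -scalemxAr -!scalemxAl mxtraceD mxtraceZ.
Qed.

Lemma mxtrace_mulmx_tr x : \tr (x *m x^T) = \sum_i \sum_j x i j ^+ 2.
Proof.
apply: eq_bigr => i _; rewrite mxE; apply: eq_bigr => j _.
by rewrite mxE expr2.
Qed.

Lemma mxtrace_mulmx_tr_eq0 x : \tr (x *m x^T) = 0 -> x = 0.
Proof.
rewrite mxtrace_mulmx_tr => /eqP; rewrite psumr_eq0; last first.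
  by move=> i _; apply: sumr_ge0 => j _; exact: sqr_ge0.
move=> /allP x0; apply/matrixP => i j; rewrite mxE; apply/eqP.
have /x0 /= : i \in index_enum 'I_n by rewrite mem_index_enum.
rewrite psumr_eq0 => [/allP/(_ j)|k _]; last exact: sqr_ge0.
by rewrite mem_index_enum sqrf_eq0 => /(_ isT).
Qed.

(** Pairing [x] with [q x q], where [q] is the inverse of [Q], gives the sum of the
    squares of the entries of [q x q]. *)
Lemma trace_metric_nondegenerate Q x : Q \in Sym n -> Q \in unitmx ->
  x \in Sym n -> {in Sym n, forall y, trace_metric Q x y = 0} -> x = 0.
Proof.
move=> QS Qu /SymP xT x0.
set q := invmx Q.
have qxqT : (q *m x *m q)^T = q *m x *m q.
  by rewrite !trmx_mul (trmx_invSym QS) xT mulmxA.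
have /mxtrace_mulmx_tr_eq0 qxq0 : \tr ((q *m x *m q) *m (q *m x *m q)^T) = 0.
  by rewrite qxqT; apply: x0; apply/SymP.
have : Q *m (q *m x *m q) *m Q = x by rewrite mulmxA mulKVmx// mulmxKV.
by rewrite qxq0 mulmx0 mul0mx.
Qed.

Definition trace_christoffel Q x y : V :=
  - 2^-1 *: (x *m invmx Q *m y + y *m invmx Q *m x).

Lemma trace_christoffel_Sym Q : Q \in Sym n ->
  {in Sym n &, forall x y, trace_christoffel Q x y \in Sym n}.
Proof.
move=> QS x y /SymP xT /SymP yT; rewrite rpredZ//; apply/SymP.
by rewrite linearD/= !trmx_mul (trmx_invSym QS) xT yT !mulmxA addrC.
Qed.

Lemma trace_christoffelC Q x y :
  trace_christoffel Q x y = trace_christoffel Q y x.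
Proof. by rewrite /trace_christoffel addrC. Qed.

Lemma trace_christoffel_linear Q y : linear (trace_christoffel Q y).
Proof.
move=> a x x'; rewrite /trace_christoffel mulmxDr !mulmxDl.
rewrite -!scalemxAr -!scalemxAl.
by rewrite addrACA -scalerDr [LHS]scalerDr !scalerA mulrC.
Qed.

Lemma near_unit_line Q x : Q \in unitmx ->
  \forall h \near (0 : R), h *: x + Q \in unitmx.
Proof.
move=> Qu; have dl := is_derive_affine Q x.
by apply: near_unitmx => //; rewrite scale0r add0r.
Qed.

Lemma is_derive_invmx_line Q x : Q \in unitmx ->
  is_derive (0 : R) (1 : R) (fun h : R => invmx (h *: x + Q))
    (- (invmx Q *m x *m invmx Q)).
Proof.
move=> Qu; have dl := is_derive_affine Q x.
by have := is_derive_invmx dl; rewrite scale0r add0r; exact.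
Qed.

(** The Leibniz rule, with one term for each of the two inverses in the metric. *)
Lemma derive_trace_metric Q x y z : Q \in unitmx ->
  'D_x (fun P => trace_metric P y z) Q =
  - \tr (invmx Q *m x *m invmx Q *m y *m invmx Q *m z)
  - \tr (invmx Q *m y *m invmx Q *m x *m invmx Q *m z).
Proof.
move=> Qu; have dq := is_derive_invmx_line x Qu.
suff [_ ->] : is_derive Q x (fun P => trace_metric P y z)
  (- \tr (invmx Q *m x *m invmx Q *m y *m invmx Q *m z)
   - \tr (invmx Q *m y *m invmx Q *m x *m invmx Q *m z)) by [].
apply/is_derive_line; have := is_derive_mxtrace (is_derive_mulmx
  (is_derive_mulmx (is_derive_mulmx dq (is_derive_cst y _ _)) dq)
  (is_derive_cst z _ _)).
move/is_derive_eq; apply.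
rewrite !mulmx0 !addr0 /cst/= scale0r add0r !mulNmx mulmxN mulmxDl mulNmx.
by rewrite mulNmx !mulmxA mxtraceD !raddfN.
Qed.

(** Of the four traces produced by metric compatibility, three are already words
    of [derive_trace_metric]; the fourth becomes one by cyclicity of the trace. *)
Lemma levi_civita_trace_metric Q : Q \in Sym n -> Q \in unitmx ->
  {in Sym n &, levi_civita (Sym n) trace_metric Q =2 trace_christoffel Q}.
Proof.
move=> QS Qu; apply: levi_civitaE.
- by move=> x y _ _; exact: trace_metricC.
- move=> x x' y _ _ _; rewrite addrC -scaleN1r trace_metricD mulN1r addrC //.
- by move=> x xS; exact: trace_metric_nondegenerate.
- split; first exact: trace_christoffel_Sym.
    move=> a x x' y _ _ _.
    by rewrite ![trace_christoffel _ _ y]trace_christoffelC trace_christoffel_linear.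
  by move=> a x y y' _ _ _; rewrite trace_christoffel_linear.
- by move=> x y _ _; exact: trace_christoffelC.
- move=> x y z _ _ _; rewrite derive_trace_metric//.
  rewrite /trace_metric /trace_christoffel.
  rewrite -!scalemxAr -!scalemxAl !mxtraceZ !mulmxDr !mulmxDl !mxtraceD.
  set q := invmx Q; rewrite !mulmxA.
  rewrite (_ : \tr (q *m y *m q *m z *m q *m x) =
    \tr (q *m x *m q *m y *m q *m z)); last first.
    by rewrite -(mulmxA (q *m y *m q *m z)) mxtrace_mulC !mulmxA.
  lra.
Qed.

(** * Curvature *)

(** The inner covariant derivative is the field [P |-> trace_christoffel P y z], but
    only at invertible symmetric [P]; this suffices because the outer derivative is
    taken along a symmetric direction. *)
Lemma nabla_cst Q x y z : Q \in Sym n -> Q \in unitmx -> x \in Sym n ->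
  y \in Sym n -> z \in Sym n ->
  nabla (Sym n) trace_metric (cst x)
    (nabla (Sym n) trace_metric (cst y) (cst z)) Q =
  2^-1 *: (y *m invmx Q *m x *m invmx Q *m z +
           z *m invmx Q *m x *m invmx Q *m y) +
  trace_christoffel Q x (trace_christoffel Q y z).
Proof.
move=> QS Qu xS yS zS.
have nablaE P : nabla (Sym n) trace_metric (cst y) (cst z) P =
    levi_civita (Sym n) trace_metric P y z.
  by rewrite /nabla derive_cst add0r.
rewrite {1}/nabla nablaE levi_civita_trace_metric//; last first.
  by rewrite levi_civita_trace_metric// trace_christoffel_Sym.
rewrite [levi_civita _ _ _ _ _]levi_civita_trace_metric//; congr (_ + _).
suff [_ ->] : is_derive Q x (nabla (Sym n) trace_metric (cst y) (cst z))
  (2^-1 *: (y *m invmx Q *m x *m invmx Q *m z +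
           z *m invmx Q *m x *m invmx Q *m y)) by [].
apply/is_derive_line.
apply: (@near_eq_is_derive _ _ _
  (fun h : R => trace_christoffel (h *: x + Q) y z)).
  near=> h; rewrite nablaE levi_civita_trace_metric//.
    by rewrite rpredD// rpredZ.
  by near: h; exact: near_unit_line.
have dq := is_derive_invmx_line x Qu.
have dm (a b : V) := is_derive_mulmx (is_derive_mulmx (is_derive_cst a _ _) dq)
  (is_derive_cst b _ _).
have := is_deriveZ (- 2^-1) (is_deriveD (dm y z) (dm z y)).
move/is_derive_eq; apply.
rewrite !mulmx0 !mul0mx !addr0 !add0r /cst/= !mulmxN !mulNmx !mulmxA.
by rewrite -opprD scaleNr scalerN opprK.
Unshelve. all: by end_near. Qed.

(** The derivative of the connection contributes coefficients of absolute value
    1/2 and the quadratic part 1/4, of opposite sign on the words with [z] at an end,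
    while the words with [z] in the middle cancel within the quadratic part.  The
    result is grouped as required by [trace_on_Sym]. *)
Lemma curvature_trace_metric Q x y z : Q \in Sym n -> Q \in unitmx ->
  x \in Sym n -> y \in Sym n -> z \in Sym n ->
  let q := invmx Q in
  curvature (Sym n) trace_metric (cst y) (cst x) (cst z) Q =
  4^-1 *: ((x *m q) *m y *m (q *m z) + (z *m q) *m y *m (q *m x)) -
  4^-1 *: (y *m (q *m x *m q *m z) + (z *m q *m x *m q) *m y).
Proof.
move=> QS Qu xS yS zS q; rewrite /curvature !nabla_cst//.
rewrite /nabla [lie_bracket _ _ _](_ : _ = 0); last first.
  by rewrite /lie_bracket !derive_cst subrr.
rewrite derive_cst levi_civita_trace_metric ?rpred0//.
(* The fifth occurrence is the term of the Lie bracket, which vanishes. *)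
rewrite {5}/trace_christoffel !mul0mx !mulmx0 addr0 scaler0 addr0 subr0.
rewrite /trace_christoffel -/q -!scalemxAr -!scalemxAl !mulmxDr !mulmxDl !mulmxA.
(* What remains is a linear relation between the six words in [x], [y], [z]. *)
move: (x *m q *m y *m q *m z) (x *m q *m z *m q *m y)
  (y *m q *m x *m q *m z) (y *m q *m z *m q *m x)
  (z *m q *m x *m q *m y) (z *m q *m y *m q *m x) => xyz xzy yxz yzx zxy zyx.
by apply/matrixP => i j; rewrite !mxE; lra.
Qed.

End Symmetric.

(** * Traces on a space of matrices *)

Section trace_on.
Context {R : realType} {n : nat} (E : {vspace 'M[R]_n}).
Local Notation V := 'M[R]_n.
Implicit Types F : V -> V.

Lemma eq_trace_on F F' : {in E, F =1 F'} -> trace_on E F = trace_on E F'.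
Proof.
by move=> FF'; apply: eq_bigr => i _; rewrite FF'// vbasis_mem// memt_nth.
Qed.

Lemma trace_onB F F' (a b : R) :
  trace_on E (fun y => a *: F y - b *: F' y) = a * trace_on E F - b * trace_on E F'.
Proof.
rewrite /trace_on !mulr_sumr -sumrB; apply: eq_bigr => i _.
by rewrite linearB !linearZ.
Qed.

Lemma trace_on_id (c : R) : trace_on E (fun y => c *: y) = c * (\dim E)%:R.
Proof.
rewrite /trace_on -[in RHS](card_ord (\dim E)) -sum1_card natr_sum mulr_sumr.
apply: eq_bigr => i _.
by rewrite linearZ/= coord_free ?eqxx// (basis_free (vbasisP E)).
Qed.

(** The trace of [F] on [E] is that of [F \o pi] on the whole space, for any
    projection [pi] onto [E], and the latter can be read off the standard basis. *)
Lemma trace_on_proj F (pi : V -> V) :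
  linear F -> linear pi -> {in E, forall y, F y \in E} ->
  (forall y, pi y \in E) -> {in E, pi =1 id} ->
  trace_on E F = \sum_i \sum_j F (pi (delta_mx i j)) i j.
Proof.
move=> linF linpi FE piE piid.
pose Fl : {linear V -> V} :=
  HB.pack_for {linear V -> V} F (GRing.isLinear.Build R V V *:%R F linF).
pose pil : {linear V -> V} :=
  HB.pack_for {linear V -> V} pi (GRing.isLinear.Build R V V *:%R pi linpi).
pose e i := (vbasis E)`_i.
have eE i : (i < \dim E)%N -> e i \in E.
  by move=> iE; rewrite vbasis_mem// mem_nth// size_tuple.
have Fpi y : F (pi y) = \sum_(k < \dim E) coord (vbasis E) k (pi y) *: F (e k).
  rewrite {1}(coord_vbasis (piE y)) -[F]/(Fl : V -> V) linear_sum.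
  by apply: eq_bigr => k _; rewrite linearZ.
under eq_bigr => i _ do under eq_bigr => j _ do
  rewrite Fpi summxE.
under eq_bigr => i _ do rewrite exchange_big/=.
rewrite exchange_big/=; apply: eq_bigr => k _; rewrite -/(e k).
rewrite -{1}(piid _ (FE _ (eE _ (ltn_ord k)))) [F (e k) in LHS]matrix_sum_delta.
rewrite -[pi]/(pil : V -> V) !linear_sum; apply: eq_bigr => i _.
rewrite !linear_sum; apply: eq_bigr => j _.
by rewrite !linearZ/= mxE mulrC.
Qed.

End trace_on.

Section trace_Sym.
Context {R : realType} {n : nat}.
Local Notation V := 'M[R]_n.
Implicit Types a b : V.

Lemma mulmx_delta_mulmx a b i j k l :
  (a *m delta_mx i j *m b) k l = a k i * b j l.
Proof.
rewrite -(mul_delta_mx (0 : 'I_1)) mulmxA -mulmxA -colE -rowE mxE big_ord1.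
by rewrite !mxE.
Qed.

(** With [pi] the symmetrization, [F \o pi] is half the sum of [y |-> a y b],
    [y |-> a y^T b] and the transposes of their values.  On all matrices the first
    has trace [tr a tr b] and the second [tr (a^T b)]. *)
Lemma trace_on_Sym a b :
  trace_on (Sym n) (fun y => a *m y *m b + b^T *m y *m a^T) =
  \tr a * \tr b + \tr (a^T *m b).
Proof.
pose pi (y : V) := 2^-1 *: (y + y^T).
rewrite (@trace_on_proj _ _ _ _ pi).
- have trE : \tr (a^T *m b) = \sum_i \sum_j a i j * b i j.
    rewrite /mxtrace exchange_big/=; apply: eq_bigr => i _.
    by rewrite mxE; apply: eq_bigr => j _; rewrite mxE.
  have trM : \tr a * \tr b = \sum_i \sum_j a i i * b j j.
    by rewrite big_distrl/=; apply: eq_bigr => i _; rewrite big_distrr.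
  (* The entry at [(i, j)] is [(f i j + f j i) / 2] for
     [f i j = a i i * b j j + a i j * b i j]; only the sums agree. *)
  have sym_sum (f : 'I_n -> 'I_n -> R) :
      \sum_i \sum_j f i j = \sum_i \sum_j (2^-1 * f i j + 2^-1 * f j i).
    under [RHS]eq_bigr => i _ do rewrite big_split/= -!mulr_sumr.
    rewrite big_split/= -!mulr_sumr [X in _ + _ * X]exchange_big/=; lra.
  rewrite trE trM -big_split/=.
  under [RHS]eq_bigr => i _ do rewrite -big_split/=.
  rewrite [RHS]sym_sum; apply: eq_bigr => i _; apply: eq_bigr => j _ /=.
  rewrite /pi trmx_delta -!scalemxAr -!scalemxAl !mulmxDr !mulmxDl.
  have mxED (x y : V) : (x + y) i j = x i j + y i j by rewrite mxE.
  have mxEZ c (x : V) : (c *: x) i j = c * x i j by rewrite mxE.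
  rewrite !(mxED, mxEZ) !mulmx_delta_mulmx !mxE; lra.
- move=> c x y; rewrite !mulmxDr !mulmxDl -!scalemxAr -!scalemxAl.
  by rewrite addrACA -scalerDr.
- move=> c x y; rewrite /pi linearP/= addrACA -scalerDr [LHS]scalerDr.
  by rewrite !scalerA mulrC.
- move=> y /SymP yT; apply/SymP.
  by rewrite linearD/= !trmx_mul !trmxK yT !mulmxA addrC.
- by move=> y; rewrite rpredZ//; apply/SymP; rewrite linearD/= trmxK addrC.
- move=> y /SymP yT.
  by rewrite /pi yT -mulr2n -(scaler_nat 2 y) scalerA mulVf ?scale1r.
Qed.

(** For [a = b = 1] the map of [trace_on_Sym] is multiplication by 2 on the
    symmetric matrices. *)
Lemma dim_Sym : (\dim (Sym n : {vspace V}))%:R = n%:R * (n%:R + 1) / 2 :> R.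
Proof.
have := trace_on_Sym 1%:M 1%:M.
under eq_trace_on => y _.
  rewrite trmx1 !mul1mx !mulmx1 -mulr2n -(scaler_nat 2 y); over.
rewrite trace_on_id trmx1 mul1mx mxtrace1; lra.
Qed.

End trace_Sym.

(** * Ricci and scalar curvature *)

Section ricci_scalar.
Context {R : realType} {n : nat}.
Local Notation V := 'M[R]_n.
Local Notation S := (Sym n : {vspace V}).
Implicit Types Q x y z : V.

Lemma ricci_trace_metric Q x z : Q \in Sym n -> Q \in unitmx ->
  x \in Sym n -> z \in Sym n ->
  ricci (Sym n) trace_metric Q x z =
  4^-1 * (\tr (invmx Q *m x) * \tr (invmx Q *m z)) -
  n%:R / 4 * trace_metric Q x z.
Proof.
move=> QS Qu xS zS; set q := invmx Q.
have qT : q^T = q := trmx_invSym QS.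
have xT := SymP _ xS; have zT := SymP _ zS.
pose c := q *m x *m q *m z.
rewrite /ricci (@eq_trace_on _ _ _ _ (fun y =>
  4^-1 *: (x *m q *m y *m (q *m z) + (q *m z)^T *m y *m (x *m q)^T) -
  4^-1 *: (1%:M *m y *m c + c^T *m y *m 1%:M^T))); last first.
  move=> y yS; rewrite /c curvature_trace_metric// -/q trmx1 mul1mx mulmx1.
  by rewrite !trmx_mul qT xT zT !mulmxA.
rewrite trace_onB !trace_on_Sym trmx1 mul1mx mxtrace1 trmx_mul qT xT.
rewrite [\tr (x *m q)]mxtrace_mulC /trace_metric -/q /c !mulmxA; lra.
Qed.

Lemma trace_metric_suml Q y k (c : 'I_k -> R) (e : 'I_k -> V) :
  trace_metric Q (\sum_i c i *: e i) y = \sum_i c i * trace_metric Q (e i) y.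
Proof.
elim/big_rec2 : _ => [|i s x _ <-]; last by rewrite trace_metricD.
by rewrite /trace_metric mulmx0 !mul0mx mxtrace0.
Qed.

Lemma gram_unitmx Q : Q \in Sym n -> Q \in unitmx ->
  gram (Sym n) trace_metric Q \in unitmx.
Proof.
move=> QS Qu; rewrite unitmxE unitfE; apply/negP => /det0P[v v0 vG].
pose e (i : 'I_(\dim S)) : V := (vbasis S)`_i.
have eS i : e i \in Sym n by rewrite vbasis_mem// mem_nth// size_tuple.
have x0 : \sum_i v 0 i *: e i = 0.
  apply: (trace_metric_nondegenerate QS Qu).
    by rewrite rpred_sum// => i _; rewrite rpredZ.
  move=> y yS; rewrite (coord_vbasis yS) trace_metricC trace_metric_suml big1//.
  move=> j _; rewrite trace_metricC trace_metric_suml.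
  move/matrixP : vG => /(_ 0 j); rewrite !mxE => vG0.
  rewrite [X in _ * X](_ : _ = 0) ?mulr0// -[RHS]vG0.
  by apply: eq_bigr => i _; rewrite mxE.
move/negP : v0; apply; apply/eqP/rowP => i; rewrite mxE.
by have /freeP := basis_free (vbasisP S); exact.
Qed.

(** With [t] the row of the linear form [tr (q x)] in the chosen basis and [c] the
    coordinates of [Q], the identity [tr (q x) = g (Q, x)] reads [t = c G].  So
    [G^-1 t^T t] has the trace of [t c^T], which is [tr (q Q) = n]. *)
Lemma scalar_curvature_trace_metric Q : Q \in Sym n -> Q \in unitmx ->
  scalar_curvature (Sym n) trace_metric Q =
  - ((n%:R - 1) * n%:R * (n%:R + 2) / 8).
Proof.
move=> QS Qu; rewrite /scalar_curvature.
set G := gram _ trace_metric Q.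
pose e (i : 'I_(\dim S)) : V := (vbasis S)`_i.
have eS i : e i \in Sym n by rewrite vbasis_mem// mem_nth// size_tuple.
pose t := \row_i \tr (invmx Q *m e i).
pose c := \row_i coord (vbasis S) i Q.
have GT : G^T = G by apply/matrixP => i j; rewrite !mxE trace_metricC.
have -> : gram (Sym n) (ricci (Sym n) trace_metric) Q =
    4^-1 *: (t^T *m t) - (n%:R / 4) *: G.
  apply/matrixP => i j; rewrite mxE ricci_trace_metric//; try exact: eS.
  by rewrite !mxE big_ord1 !mxE.
have tE : t = c *m G.
  apply/rowP => j; rewrite !mxE -[invmx Q]mul1mx -(mulVmx Qu).
  rewrite -[LHS]/(trace_metric Q Q (e j)).
  rewrite {2}(coord_vbasis QS) trace_metric_suml; apply: eq_bigr => i _.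
  by rewrite !mxE.
have tc : \tr (t *m c^T) = n%:R.
  rewrite trace_mx11 mxE -(mxtrace1 R n) -(mulVmx Qu).
  rewrite {2}(coord_vbasis QS) mulmx_sumr raddf_sum; apply: eq_bigr => i _ /=.
  by rewrite !mxE -scalemxAr mxtraceZ mulrC.
rewrite mulmxBr -!scalemxAr mulVmx ?gram_unitmx// raddfB/= !mxtraceZ mxtrace1.
rewrite {1}tE trmx_mul GT -mulmxA mulKmx ?gram_unitmx// mxtrace_mulC tc dim_Sym.
by field.
Qed.

End ricci_scalar.

Theorem proposition2p4 (R : realType) (n p : nat) (hn : (2 <= n)%N)
    (hp : (p <= n)%N) :
  (forall Q X Z : 'M[R]_n, GLSym n p Q -> X \in Sym n -> Z \in Sym n ->
     ricci (Sym n) trace_metric Q X Z =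
       1 / 4 * \tr (invmx Q *m X) * \tr (invmx Q *m Z)
       - n%:R / 4 * trace_metric Q X Z) /\
  (forall Q : 'M[R]_n, GLSym n p Q ->
     scalar_curvature (Sym n) trace_metric Q =
       - ((n%:R - 1) * n%:R * (n%:R + 2) / 8)).
Proof.
split=> [Q X Z [QS Qu _] XS ZS|Q [QS Qu _]].
  by rewrite ricci_trace_metric// mulrA div1r.
exact: scalar_curvature_trace_metric.
Qed.
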